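(* Let $h(x)=d_0+\dots+d_tx^t$ be a polynomial in $\mathbb{Z}[x]$ with $d_0,d_t\neq 0$. Then the distortion $\Delta_h(l)$ of $h$ is equivalent to a polynomial. Further, the degree of this polynomial is exactly one plus the maximal multiplicity of a complex root of $h(x)$ having modulus one; that is, $\Delta_h(l)\approx l^{\kappa+1}$, where $\kappa$ is this maximal multiplicity ($\kappa=0$ if $h$ has no root of modulus one).
   Context: For $f(x)=\sum_{i=0}^n a_ix^i\in\mathbb{Z}[x]$ put $S(f)=\sum_{i=0}^n|a_i|$. For a nonzero $h\in\mathbb{Z}[x]$ and a constant $c>0$, define $\Delta_{h,c}(l)=\sup\{S(f): f\in\mathbb{Z}[x],\ \deg(f)\le cl,\ S(hf)\le cl\}$ (with $f=0$ always allowed). For non-decreasing functions $f,g$ on the nonnegative integers, $f\preceq g$ means there is an integer $C>0$ with $f(l)\le Cg(Cl)$ for all $l\ge 0$; $f\approx g$ means $f\preceq g$ and $g\preceq f$. Up to $\approx$, $\Delta_{h,c}$ does not depend on $c$, and it is denoted $\Delta_h$. *)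

(* Defs.v *)
From HB Require Import structures.
From mathcomp Require Import all_boot all_order all_algebra.
From mathcomp Require Import all_classical reals ereal.
From mathcomp Require Import complex.
Set Implicit Arguments.
Unset Strict Implicit.
Unset Printing Implicit Defensive.
Import Order.TTheory GRing.Theory Num.Theory.
Local Open Scope classical_set_scope.
Local Open Scope ring_scope.

Definition abs_coef_sum (f : {poly int}) : nat :=
  (\sum_(i < size f) absz (f`_i)%R)%N.

(* The supremum is taken in the extended reals, so that no junk value is used
   for unbounded sets. The degree (size f).-1 of f = 0 reads as 0, so f = 0
   is always in the set when 0 <= c. *)
Definition distortion (R : realType) (h : {poly int}) (c : R) (l : nat) :
    \bar R :=
  ereal_sup [set (abs_coef_sum f)%:R%:E | f in
    [set f : {poly int} | ((size f).-1)%:R <= c * l%:R /\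
                          (abs_coef_sum (h * f))%:R <= c * l%:R]].

Definition growth_le (R : realType) (f g : nat -> \bar R) : Prop :=
  exists C : nat, (0 < C)%N /\
    forall l : nat, (f l <= C%:R%:E * g (C * l)%N)%E.

Definition growth_equiv (R : realType) (f g : nat -> \bar R) : Prop :=
  growth_le f g /\ growth_le g f.

(* The bound k < size h loses nothing when h != 0: a multiplicity is at most
   the degree. If h has no root of modulus one, the maximum is 0. *)
Definition max_unit_root_mult (R : realType) (h : {poly int}) : nat :=
  let hC : {poly R[i]} := map_poly intr h in
  (\max_(k < size h |
     `[< exists z : R[i], [/\ root hC z, `|z|%R = 1%R & mup z hC = k] >]) k)%N.

Lemma mup_max_unit_root_mult (R : realType) (h : {poly int}) (z : R[i]) :
  h != 0 -> `|z| = 1 ->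
  (mup z (map_poly intr h) <= max_unit_root_mult R h)%N.
Proof.
move=> h0 z1; set hC := map_poly intr h.
have sC : size hC = size h.
  by rewrite size_map_inj_poly // => x y /eqP; rewrite eqr_int => /eqP.
have hC0 : hC != 0 by rewrite -size_poly_eq0 sC size_poly_eq0.
have [rz|nrz] := boolP (root hC z); last by rewrite mupNroot.
have ms : (mup z hC < size h)%N.
  rewrite -sC mup_ltn //; apply: contraTN isT => /(dvdp_leq hC0).
  by rewrite size_exp_XsubC ltnn.
rewrite /max_unit_root_mult.
apply: (@leq_bigmax_cond _ _ (fun k : 'I_(size h) => k : nat) (Ordinal ms)).
by apply/asboolP; exists z.
Qed.

Lemma max_unit_root_multP (R : realType) (h : {poly int}) :
  (0 < max_unit_root_mult R h)%N ->
  exists z : R[i], [/\ root (map_poly intr h) z, `|z| = 1 &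
    mup z (map_poly intr h) = max_unit_root_mult R h].
Proof.
rewrite /max_unit_root_mult /=.
set P := fun k : 'I_(size h) => `[< exists z : R[i],
  [/\ root (map_poly intr h) z, `|z| = 1 & mup z (map_poly intr h) = k] >].
rewrite -/(\max_(k < size h | P k) k)%N.
have [[k0 Pk0] _|noP] := pselect (exists k, P k).
  have c0 : (0 < #|P|)%N by apply/card_gt0P; exists k0.
  have [k Pk ->] := eq_bigmax_cond (fun k : 'I_(size h) => k : nat) c0.
  by move/asboolP: Pk.
by rewrite big_pred0 // => k; apply/negP => Pk; apply: noP; exists k.
Qed.

(* Main.v *)
Require Import Defs.
From mathcomp Require Import all_boot all_order all_algebra.
From mathcomp Require Import all_classical reals ereal.
From mathcomp Require Import complex.
Import Order.TTheory GRing.Theory Num.Theory.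
Local Open Scope ring_scope.

(** Upper bound: call [p] bounded with exponent [k] if dividing by [p] costs at
    most a factor [C (size f)^k] in coefficient norm. A factor [X - z] has
    exponent [1] if [|z| = 1] and [0] otherwise; exponents add up under
    products, but only their maximum counts for coprime factors, by Bezout.
    So [h] has exponent [kappa].
    Lower bound: let [z] be a unit root of multiplicity [kappa] (any unit
    number if [kappa = 0]) and [q = (X^l - z^l) / (X - z)]. Then [h q^kappa]
    has coefficient norm bounded independently of [l], while that of [q^kappa]
    is at least [|q(z)|^kappa = l^kappa]. Multiply [q^kappa] by a multiple of
    [l] and round it to a Gaussian integer polynomial [f1 + i f2]: since [h] is
    real, both [h f1] and [h f2] have norm [O(l)], and one of [f1], [f2] has
    norm at least [l^(kappa+1)]. *)

(** * The coefficient norm and its submultiplicativity *)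

Definition coef_norm {K : numDomainType} (p : {poly K}) : K :=
  \sum_(i < size p) `|p`_i|.

Lemma coef_norm_ge0 {K : numDomainType} (p : {poly K}) : 0 <= coef_norm p.
Proof. by apply: sumr_ge0. Qed.

Lemma coef_norm_widen {K : numDomainType} {p : {poly K}} {n : nat} :
  (size p <= n)%N -> coef_norm p = \sum_(i < n) `|p`_i|.
Proof.
move=> len; rewrite /coef_norm (big_ord_widen n (fun i => `|p`_i|) len).
rewrite big_mkcond; apply: eq_bigr => i _; case: ltnP => // lei.
by rewrite nth_default // normr0.
Qed.

Lemma partial_sum_le_coef_norm {K : numDomainType} (p : {poly K}) (n : nat) :
  \sum_(i < n) `|p`_i| <= coef_norm p.
Proof.
rewrite (coef_norm_widen (leq_maxr n (size p))).
rewrite (big_ord_widen _ (fun i => `|p`_i|) (leq_maxl n (size p))).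
by rewrite big_mkcond ler_sum // => i _; case: ifP.
Qed.

Lemma coef_norm0 {K : numDomainType} : coef_norm (0 : {poly K}) = 0.
Proof. by rewrite /coef_norm size_poly0 big_ord0. Qed.

Lemma le_coef_norm {K : numDomainType} (p q : {poly K}) :
  (forall i, `|p`_i| <= `|q`_i|) -> coef_norm p <= coef_norm q.
Proof.
move=> lepq; apply: le_trans (partial_sum_le_coef_norm q (size p)).
by apply: ler_sum => i _.
Qed.

Lemma coef_normD {K : numDomainType} (p q : {poly K}) :
  coef_norm (p + q) <= coef_norm p + coef_norm q.
Proof.
set n := maxn (size p) (size q).
rewrite (coef_norm_widen (leq_maxl _ _ : size p <= n)%N).
rewrite (coef_norm_widen (leq_maxr _ _ : size q <= n)%N).
rewrite (coef_norm_widen (size_polyD p q)) -big_split /=.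
by apply: ler_sum => i _; rewrite coefD ler_normD.
Qed.

Lemma coef_normZ {K : numDomainType} (a : K) (p : {poly K}) :
  coef_norm (a *: p) = `|a| * coef_norm p.
Proof.
rewrite (coef_norm_widen (size_scale_leq a p)) /coef_norm mulr_sumr.
by apply: eq_bigr => i _; rewrite coefZ normrM.
Qed.

Lemma coef_normN {K : numDomainType} (p : {poly K}) :
  coef_norm (- p) = coef_norm p.
Proof. by rewrite -scaleN1r coef_normZ normrN1 mul1r. Qed.

Lemma coef_norm_MXaddC {K : numDomainType} (p : {poly K}) (a : K) :
  coef_norm (p * 'X + a%:P) = coef_norm p + `|a|.
Proof.
have le : (size (p * 'X + a%:P)%R <= (size p).+1)%N.
  by rewrite size_MXaddC; case: ifP.
rewrite (coef_norm_widen le) big_ord_recl /= addrC; congr (_ + _).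
  by apply: eq_bigr => i _; rewrite coefD coefMX coefC /= addr0.
by rewrite coefD coefMX coefC /= add0r.
Qed.

Lemma coef_normM {K : numDomainType} (p q : {poly K}) :
  coef_norm (p * q) <= coef_norm p * coef_norm q.
Proof.
elim/poly_ind: p => [|p a IH]; first by rewrite mul0r coef_norm0 mul0r.
rewrite coef_norm_MXaddC mulrDl mulrDl mul_polyC.
apply: le_trans (coef_normD _ _) _; rewrite coef_normZ lerD2r.
(* A shift by ['X] keeps the norm: this is [coef_norm_MXaddC] with constant term 0. *)
rewrite -[p * 'X * q]addr0 -mulrA [_ * q]mulrC mulrA.
by rewrite -[0](@polyC0 K) coef_norm_MXaddC normr0 addr0.
Qed.

Lemma coef_normC {K : numDomainType} (a : K) : coef_norm a%:P = `|a|.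
Proof.
rewrite -[a%:P]add0r -[X in X + _](mul0r 'X).
by rewrite coef_norm_MXaddC coef_norm0 add0r.
Qed.

Lemma coef_normX {K : numDomainType} (p : {poly K}) (n : nat) :
  coef_norm (p ^+ n) <= coef_norm p ^+ n.
Proof.
elim: n => [|n IH]; first by rewrite !expr0 -[1]/(1%:P) coef_normC normr1.
rewrite !exprS; apply: le_trans (coef_normM _ _) _.
by rewrite ler_wpM2l ?coef_norm_ge0.
Qed.

Lemma coef_norm_sum {K : numDomainType} (n : nat) (F : 'I_n -> {poly K}) :
  coef_norm (\sum_(i < n) F i) <= \sum_(i < n) coef_norm (F i).
Proof.
elim/big_ind2: _ => // [|x1 x2 y1 y2 H1 H2]; first by rewrite coef_norm0.
by apply: le_trans (coef_normD _ _) _; apply: lerD.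
Qed.

Lemma coef_normXn {K : numDomainType} (n : nat) :
  coef_norm ('X^n : {poly K}) = 1.
Proof.
rewrite /coef_norm size_polyXn big_ord_recr /= coefXn eqxx normr1 big1 ?add0r //.
by move=> i _; rewrite coefXn ltn_eqF ?normr0.
Qed.

Lemma norm_horner_le {K : numDomainType} (p : {poly K}) (z : K) :
  `|z| = 1 -> `|p.[z]| <= coef_norm p.
Proof.
move=> z1; rewrite horner_coef; apply: le_trans (ler_norm_sum _ _ _) _.
by apply: ler_sum => i _; rewrite normrM normrX z1 expr1n mulr1.
Qed.

(** * The quotient of ['X^n - z^n] by ['X - z] *)

Definition geom_poly {K : comNzRingType} (z : K) (n : nat) : {poly K} :=
  \sum_(i < n) 'X^(n.-1 - i) * z%:P ^+ i.

Lemma geom_polyM {K : comNzRingType} (z : K) (n : nat) :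
  ('X - z%:P) * geom_poly z n = 'X^n - (z ^+ n)%:P.
Proof. by rewrite polyC_exp subrXX. Qed.

Lemma size_geom_poly {K : comNzRingType} (z : K) (n : nat) :
  (size (geom_poly z n) <= n)%N.
Proof.
apply: leq_trans (size_sum _ _ _) _; apply/bigmax_leqP => i _.
rewrite -polyC_exp mulrC mul_polyC; apply: leq_trans (size_scale_leq _ _) _.
rewrite size_polyXn; have := ltn_ord i; case: n i => [[]//|n i _] /=.
by rewrite ltnS leq_subr.
Qed.

Lemma coef_norm_geom_poly {K : numDomainType} (z : K) (n : nat) :
  `|z| = 1 -> coef_norm (geom_poly z n) <= n%:R.
Proof.
move=> z1; apply: le_trans (coef_norm_sum _ _) _.
rewrite -[X in X%:R](card_ord n) -sum1_card natr_sum; apply: ler_sum => i _.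
rewrite -polyC_exp mulrC mul_polyC coef_normZ normrX z1 expr1n.
by rewrite coef_normXn mulr1.
Qed.

Lemma norm_horner_geom_poly {K : numDomainType} (z : K) (n : nat) :
  `|z| = 1 -> `|(geom_poly z n).[z]| = n%:R.
Proof.
move=> z1; rewrite /geom_poly horner_sum.
under eq_bigr => i _.
  rewrite -polyC_exp hornerM hornerXn hornerC -exprD subnK; last first.
    by case: n i => [[]//|n i]; rewrite -ltnS.
  over.
by rewrite sumr_const card_ord normrMn normrX z1 expr1n.
Qed.

(** * The cost of dividing by a polynomial *)

Definition mul_bounds {K : numDomainType} (p : {poly K}) (k : nat) : Prop :=
  exists2 C : K, 0 <= C & forall f : {poly K},
    coef_norm f <= C * (size f)%:R ^+ k * coef_norm (p * f).

Lemma mul_bounds_leq {K : numDomainType} {p : {poly K}} {k m : nat} :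
  (k <= m)%N -> mul_bounds p k -> mul_bounds p m.
Proof.
move=> km [C C0 Cf]; exists C => // f.
(* Raising the exponent needs [size f] at least 1, so [f = 0] is treated apart. *)
have [->|f0] := eqVneq f 0; first by rewrite coef_norm0 mulr0 coef_norm0 mulr0.
apply: le_trans (Cf f) _; rewrite ler_wpM2r ?coef_norm_ge0 // ler_wpM2l //.
by apply: ler_weXn2l => //; rewrite ler1n lt0n size_poly_eq0.
Qed.

(** The product form lets a [k]-th power of [size (p * f)] be absorbed into the constant. *)
Lemma size_mul_leq_mul {K : numDomainType} (p f : {poly K}) :
  f != 0 -> (size (p * f)%R <= (size p).+1 * size f)%N.
Proof.
rewrite -size_poly_eq0 -lt0n => f0; apply: leq_trans (size_polyMleq _ _) _.
rewrite mulSn addnC; apply: leq_trans (leq_pred _) _.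
by rewrite leq_add2l leq_pmulr.
Qed.

(** The bound for [q] is applied to [p * f], whose size is linear in that of [f]. Both the product
    and the coprime case rest on this. *)
Lemma mul_bounds_after {K : numDomainType} {p q : {poly K}} {k : nat} :
  mul_bounds q k -> exists2 C : K, 0 <= C & forall f : {poly K},
    coef_norm (p * f) <= C * (size f)%:R ^+ k * coef_norm (p * q * f).
Proof.
move=> [C C0 Cf]; exists (C * (size p).+1%:R ^+ k).
  by rewrite mulr_ge0 // exprn_ge0.
move=> f; have [->|f0] := eqVneq f 0.
  by rewrite !mulr0 coef_norm0 mulr0.
apply: le_trans (Cf _) _; rewrite mulrA [q * p]mulrC.
rewrite ler_wpM2r ?coef_norm_ge0 // -mulrA ler_wpM2l // -exprMn -natrM.
by rewrite lerXn2r ?nnegrE ?ler0n // ler_nat size_mul_leq_mul.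
Qed.

Lemma mul_boundsM {K : numDomainType} {p q : {poly K}} {k m : nat} :
  mul_bounds p k -> mul_bounds q m -> mul_bounds (p * q) (k + m).
Proof.
move=> [C C0 Cf] /(mul_bounds_after (p := p)) [D D0 Df]; exists (C * D).
  exact: mulr_ge0.
move=> f; apply: le_trans (Cf f) _; rewrite exprD mulrACA -[leRHS]mulrA.
by rewrite ler_wpM2l ?mulr_ge0 ?exprn_ge0.
Qed.

(* With [u p + v q = 1], [f = u (p f) + v (q f)], and both [p f] and [q f]
   are quotients of [p q f]; hence exponents do not add up. *)
Lemma mul_bounds_coprime {K : numFieldType} {p q : {poly K}} {k : nat} :
  coprimep p q -> mul_bounds p k -> mul_bounds q k -> mul_bounds (p * q) k.
Proof.
move=> /Bezout_eq1_coprimepP [[u v] /= uv].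
move=> /(mul_bounds_after (p := q)) [D D0 Df].
move=> /(mul_bounds_after (p := p)) [C C0 Cf].
exists (coef_norm u * C + coef_norm v * D).
  by rewrite addr_ge0 ?mulr_ge0 ?coef_norm_ge0.
move=> f; have -> : coef_norm f = coef_norm (u * (p * f) + v * (q * f)).
  by rewrite !mulrA -mulrDl uv mul1r.
apply: le_trans (coef_normD _ _) _; rewrite !mulrDl -!mulrA.
apply: lerD; (apply: le_trans (coef_normM _ _) _);
  rewrite ler_wpM2l ?coef_norm_ge0 //.
  by have := Cf f; rewrite -!mulrA.
by have := Df f; rewrite (mulrC q p) -!mulrA.
Qed.

Lemma mul_boundsX {K : numDomainType} (p : {poly K}) (k m : nat) :
  mul_bounds p k -> mul_bounds (p ^+ m) (m * k).
Proof.
move=> pk; elim: m => [|m IH]; last by rewrite exprS mulSn; apply: mul_boundsM.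
by exists 1 => // f; rewrite expr0 !mul1r.
Qed.

Lemma mul_bounds_polyC {K : numFieldType} (a : K) :
  a != 0 -> mul_bounds a%:P 0.
Proof.
move=> a0; exists `|a|^-1; first by rewrite invr_ge0.
by move=> f; rewrite mulr1 mul_polyC coef_normZ mulKf ?normr_eq0.
Qed.

(* [X^n - z^n] with [n = size f] acts on [f] without overlap. *)
Lemma mul_bounds_XsubC_unit {K : numDomainType} (z : K) :
  `|z| = 1 -> mul_bounds ('X - z%:P) 1.
Proof.
move=> z1; exists 1 => // f; rewrite mul1r expr1; set n := size f.
have : coef_norm f <= coef_norm (geom_poly z n * (('X - z%:P) * f)).
  rewrite mulrA [_ * ('X - _)]mulrC geom_polyM.
  apply: le_trans (partial_sum_le_coef_norm _ n).
  apply: ler_sum => i _; rewrite mulrBl coefB coefXnM ltn_ord sub0r normrN.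
  by rewrite coefCM normrM normrX z1 expr1n mul1r.
move/le_trans; apply; apply: le_trans (coef_normM _ _) _.
by rewrite ler_wpM2r ?coef_norm_ge0 // coef_norm_geom_poly.
Qed.

(** Multiplication by ['X] preserves the norm and scaling by [z] multiplies it by [|z|], so by the
    triangle inequality the two terms of [('X - z) * f] cannot cancel beyond the factor
    [| |z| - 1 |]. *)
Lemma mul_bounds_XsubC_nonunit {K : numFieldType} (z : K) :
  `|z| != 1 -> mul_bounds ('X - z%:P) 0.
Proof.
move=> z1; have z0 : `| `|z| - 1 | != 0 by rewrite normr_eq0 subr_eq0.
exists (`| `|z| - 1 |^-1); first by rewrite invr_ge0.
move=> f; rewrite mulr1 -ler_pdivrMl ?invr_gt0 ?lt_def ?z0 ?normr_ge0 //.
rewrite invrK mulrBl [_ * f]mulrC mul_polyC.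
have Xf : coef_norm (f * 'X) = coef_norm f.
  by rewrite -[f * 'X]addr0 -[0](@polyC0 K) coef_norm_MXaddC normr0 addr0.
have ge1 := coef_normD (f * 'X - z *: f) (z *: f).
have ge2 := coef_normD (f * 'X) (- (f * 'X - z *: f)).
move: ge1 ge2; rewrite subrK subKr coef_normZ coef_normN Xf.
set S := coef_norm (_ - _); rewrite -lerBlDr -lerBlDl => ge1 ge2.
have S0 : 0 <= coef_norm f := coef_norm_ge0 f.
have := real_leVge (normr_real z) (@real1 K).
case/orP => h1.
  by rewrite ler0_norm ?subr_le0 // opprB mulrBl mul1r.
by rewrite ger0_norm ?subr_ge0 // mulrBl mul1r.
Qed.

(** Induction on the size: the full power of ['X - z] at a root [z] is split off. It is coprime to
    the cofactor, so the exponents do not add up. *)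
Lemma mul_bounds_mup {K : numClosedFieldType} (p : {poly K}) (k : nat) :
  p != 0 -> (forall z, `|z| = 1 -> (mup z p <= k)%N) -> mul_bounds p k.
Proof.
have [n] := ubnP (size p); elim: n p => // n IH p sp p0 mp.
have [/size_poly1P [a a0 ->]|/closed_rootP [z rz]] := boolP (size p == 1%N).
  exact: mul_bounds_leq (leq0n k) (mul_bounds_polyC _ a0).
have := mup_geq z (mup z p) p0; rewrite leqnn => /esym/dvdpP [q pq].
have q0 : q != 0 by apply: contraNneq p0 => q0; rewrite pq q0 mul0r.
have m0 : (0 < mup z p)%N by rewrite -XsubC_dvd // dvdp_XsubCl.
have Xm0 : ('X - z%:P) ^+ mup z p != 0 by rewrite expf_neq0 ?polyXsubC_eq0.
(* Multiplicities add up over the product, so none is left for [q]. *)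
have rq : ~~ root q z.
  apply/negP => rq; have: (0 < mup z q)%N by rewrite -XsubC_dvd // dvdp_XsubCl.
  have := congr1 (mup z) pq; rewrite mupM // mup_XsubCX eqxx => /eqP.
  by rewrite -{1}[mup z p]add0n eqn_add2r => /eqP <-.
rewrite pq; apply: mul_bounds_coprime.
- by rewrite coprimep_expr // coprimep_XsubC.
- apply: IH => //.
    rewrite -ltnS (leq_trans _ sp) // ltnS pq.
    rewrite size_Mmonic ?monic_exp ?monicXsubC //.
    by rewrite size_exp_XsubC addnS /= -addn1 leq_add2l.
  by move=> y /mp; apply: leq_trans; rewrite pq mupM // leq_addr.
have [z1|z1] := eqVneq `|z| 1.
  apply: (mul_bounds_leq (mp z z1)); rewrite -{2}[mup z p]muln1.
  exact: mul_boundsX (mul_bounds_XsubC_unit _ z1).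
apply: (mul_bounds_leq (leq0n k)); rewrite -(muln0 (mup z p)).
exact: mul_boundsX (mul_bounds_XsubC_nonunit _ z1).
Qed.

(** * From integer to complex polynomials and back by rounding *)

Lemma coef_norm_intr {K : numDomainType} (f : {poly int}) :
  coef_norm (map_poly intr f : {poly K}) = (abs_coef_sum f)%:R.
Proof.
rewrite (coef_norm_widen (size_poly _ _)) /abs_coef_sum natr_sum.
by apply: eq_bigr => i _; rewrite coef_map natr_absz -intr_norm.
Qed.

(** A nonnegative complex number is real; this turns complex constants into natural ones. *)
Lemma complex_nat_bound {R : realType} (x : R[i]) :
  0 <= x -> exists n : nat, x <= n%:R.
Proof.
move=> x0; exists (Num.trunc (complex.Re x)).+1.
rewrite -(RRe_real (ger0_real x0)) -(rmorph_nat (real_complex R)) lecR.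
exact/ltW/truncnS_gt.
Qed.

Lemma coef_norm_Re_le {K : numClosedFieldType} (f g : {poly int}) :
  coef_norm (map_poly intr f : {poly K}) <=
  coef_norm (map_poly intr f + 'i *: map_poly intr g : {poly K}).
Proof.
apply: le_coef_norm => i; rewrite coefD coefZ !coef_map /=.
have fK : (f`_i)%:~R \is @Num.real K by rewrite realz.
have gK : (g`_i)%:~R \is @Num.real K by rewrite realz.
by rewrite -{1}(Re_rect fK gK) leif_normC_Re_Creal.
Qed.

Lemma coef_norm_Im_le {K : numClosedFieldType} (f g : {poly int}) :
  coef_norm (map_poly intr g : {poly K}) <=
  coef_norm (map_poly intr f + 'i *: map_poly intr g : {poly K}).
Proof.
(* Taking out ['i] exchanges real and imaginary parts up to sign. *)
have -> : (map_poly intr f + 'i *: map_poly intr g : {poly K}) =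
    'i *: (map_poly intr g + 'i *: map_poly intr (- f)).
  by rewrite scalerDr scalerA -expr2 sqrCi rmorphN scaleN1r opprK addrC.
by rewrite coef_normZ normCi mul1r; apply: coef_norm_Re_le.
Qed.

Lemma norm_sub_floor {R : realType} (x : R) :
  `|(x%:C)%C - (Num.floor x)%:~R| <= 1 :> R[i].
Proof.
rewrite -(rmorph_int (real_complex R)) -rmorphB normc_def /= expr0n addr0.
rewrite sqrtr_sqr -[leRHS](rmorph1 (real_complex R)) lecR.
rewrite ger0_norm ?subr_ge0 ?floor_le //.
by rewrite lerBlDl -[1]/(1%:~R) -intrD ltW // floorD1_gt.
Qed.

(** Taking floors of the real and imaginary parts costs at most 1 each, hence 2 per coefficient. *)
Lemma gaussian_rounding {R : realType} (F : {poly R[i]}) :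
  exists f g : {poly int}, [/\ (size f <= size F)%N, (size g <= size F)%N &
    coef_norm (F - (map_poly intr f + 'i *: map_poly intr g))
      <= (2 * size F)%:R].
Proof.
exists (\poly_(i < size F) Num.floor (complex.Re F`_i)).
exists (\poly_(i < size F) Num.floor (complex.Im F`_i)).
split; try exact: size_poly.
rewrite (@coef_norm_widen _ _ (size F)); last first.
  apply/leq_sizeP => i le.
  rewrite coefB coefD coefZ !coef_map !coef_poly ltnNge le /=.
  by rewrite nth_default // mulr0 addr0 subr0.
apply: (@le_trans _ _ (\sum_(i < size F) 2)); last first.
  by rewrite sumr_const card_ord -mulrnA.
apply: ler_sum => i _; rewrite coefB coefD coefZ !coef_map !coef_poly ltn_ord.
rewrite {1}[F`_i]Crect -complexRe -complexIm opprD addrACA -mulrBr.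
apply: le_trans (ler_normD _ _) _; rewrite normrM normCi mul1r.
by rewrite -[2]/(1 + 1) lerD // norm_sub_floor.
Qed.

(** * Lower bound: large polynomials with a small multiple *)

Lemma large_quotient (R : realType) (h : {poly int}) :
  h != 0 -> let k := max_unit_root_mult R h in
  exists D : nat, forall l : nat, (0 < l)%N -> exists f : {poly int},
    [/\ (size f <= k.+1 * l)%N, (abs_coef_sum (h * f) <= D * l)%N &
        (l ^ k.+1 <= abs_coef_sum f)%N].
Proof.
move=> h0 k; set hC : {poly R[i]} := map_poly intr h.
have hC0 : hC != 0.
  rewrite -size_poly_eq0 size_map_inj_poly ?size_poly_eq0 //.
  by move=> x y /eqP; rewrite eqr_int => /eqP.
have [z z1 /dvdpP [g hg]] : exists2 z : R[i], `|z| = 1 &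
    ('X - z%:P) ^+ k %| hC.
  have [k0|k0] := posnP k.
    by exists 1; rewrite ?normr1 // k0 expr0 dvd1p.
  have [z [_ z1 mz]] := max_unit_root_multP k0.
  by exists z; rewrite // -mup_geq // mz.
have [G gG] := complex_nat_bound _ (coef_norm_ge0 g).
(* Rounding loses at most [2 * k.+1 * l], hence at most [2 * k.+1 * l ^ k.+1]; this [A] leaves
   [2 * l ^ k.+1] to share between [f1] and [f2]. *)
pose A := (2 * k.+2)%N.
(* The first summand bounds [hC * F], the second [hC] times the rounding error. *)
exists (A * (G * 2 ^ k) + abs_coef_sum h * (2 * k.+1))%N => l l0.
pose F : {poly R[i]} := (A * l)%:R *: geom_poly z l ^+ k.
have sF : (size F <= k.+1 * l)%N.
  apply: leq_trans (size_scale_leq _ _) _.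
  apply: leq_trans (size_poly_exp_leq _ _) _.
  rewrite mulSn mulnC -add1n leq_add // leq_mul2l.
  by rewrite (leq_trans (leq_pred _)) ?size_geom_poly ?orbT.
have SF : (A * l ^ k.+1)%:R <= coef_norm F.
  rewrite coef_normZ normr_nat expnS mulnA natrM ler_wpM2l // natrX.
  rewrite -(norm_horner_geom_poly z l z1) -normrX -horner_exp.
  exact: norm_horner_le.
(* Here [hC * F] is [A * l] times [g * ('X^l - z^l) ^+ k], and ['X^l - z^l] has norm at most 2. *)
have ShF : coef_norm (hC * F) <= (A * (G * 2 ^ k) * l)%:R.
  rewrite -scalerAr coef_normZ normr_nat hg -mulrA -exprMn geom_polyM.
  rewrite mulnAC [leRHS]natrM ler_wpM2l //; apply: le_trans (coef_normM _ _) _.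
  rewrite natrM natrX ler_pM ?coef_norm_ge0 //.
  apply: le_trans (coef_normX _ _) _; apply: lerXn2r.
  - by rewrite nnegrE coef_norm_ge0.
  - by rewrite nnegrE.
  apply: le_trans (coef_normD _ _) _.
  by rewrite coef_normN coef_normC normrX z1 expr1n coef_normXn.
have [f1 [f2 [sf1 sf2]]] := gaussian_rounding F.
set f1C := map_poly _ f1; set f2C := map_poly _ f2 => rnd.
have {rnd} rnd : coef_norm (F - (f1C + 'i *: f2C)) <= (2 * (k.+1 * l))%:R.
  by apply: le_trans rnd _; rewrite ler_nat leq_mul2l.
have Shf : coef_norm (hC * (f1C + 'i *: f2C)) <=
    ((A * (G * 2 ^ k) + abs_coef_sum h * (2 * k.+1)) * l)%:R.
  rewrite -[f1C + _](subKr F) mulrBr; apply: le_trans (coef_normD _ _) _.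
  rewrite mulnDl natrD lerD // coef_normN; apply: le_trans (coef_normM _ _) _.
  by rewrite coef_norm_intr -!mulnA natrM ler_wpM2l.
have Sf : (2 * l ^ k.+1 <= abs_coef_sum f1 + abs_coef_sum f2)%N.
  have lel : (l <= l ^ k.+1)%N by rewrite expnS leq_pmulr // expn_gt0 l0.
  have : (A * l ^ k.+1 <=
      2 * (k.+1 * l) + (abs_coef_sum f1 + abs_coef_sum f2))%N.
    rewrite -(ler_nat R[i]); apply: le_trans SF _.
    rewrite -[F](subrK (f1C + 'i *: f2C)); apply: le_trans (coef_normD _ _) _.
    rewrite natrD lerD //; apply: le_trans (coef_normD _ _) _.
    by rewrite coef_normZ normCi mul1r !coef_norm_intr natrD.
  rewrite /A -[k.+2]addn1 mulnDr muln1 mulnDl => le.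
  rewrite -(leq_add2l (2 * k.+1 * l ^ k.+1)); apply: leq_trans le _.
  by rewrite leq_add2r -mulnA !leq_mul2l lel !orbT.
have hfC (f : {poly int}) : (abs_coef_sum (h * f))%:R =
    coef_norm (hC * map_poly intr f).
  by rewrite -coef_norm_intr rmorphM.
have hfE : hC * (f1C + 'i *: f2C) =
    map_poly intr (h * f1) + 'i *: map_poly intr (h * f2).
  by rewrite mulrDr -scalerAr !rmorphM.
(* One of [f1], [f2] carries at least half of the sum. *)
have [le1|lt1] := leqP (l ^ k.+1) (abs_coef_sum f1).
  exists f1; split=> //; first exact: leq_trans sF.
  rewrite -(ler_nat R[i]); apply: le_trans Shf.
  by rewrite hfE -coef_norm_intr coef_norm_Re_le.
exists f2; split=> //; first exact: leq_trans sF.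
  rewrite -(ler_nat R[i]); apply: le_trans Shf.
  by rewrite hfE -coef_norm_intr coef_norm_Im_le.
rewrite -(leq_add2l (l ^ k.+1)) addnn -mul2n; apply: leq_trans Sf _.
by rewrite leq_add2r ltnW.
Qed.

(** * Upper bound for integer polynomials *)

Lemma abs_coef_sum_upper (R : realType) (h : {poly int}) :
  h != 0 -> exists C : nat, forall f : {poly int},
    (abs_coef_sum f <=
     C * size f ^ max_unit_root_mult R h * abs_coef_sum (h * f))%N.
Proof.
move=> h0; set hC : {poly R[i]} := map_poly intr h.
have inj : injective (intr : int -> R[i]).
  by move=> x y /eqP; rewrite eqr_int => /eqP.
have hC0 : hC != 0.
  by rewrite -size_poly_eq0 size_map_inj_poly ?size_poly_eq0.
have [C C0 Cf] := mul_bounds_mup hC _ hC0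
  (fun z z1 => @mup_max_unit_root_mult R h z h0 z1).
have [n Cn] := complex_nat_bound _ C0.
exists n => f; rewrite -(ler_nat R[i]) !natrM natrX -!coef_norm_intr.
apply: le_trans (Cf _) _; rewrite rmorphM size_map_inj_poly //.
by rewrite !ler_wpM2r ?coef_norm_ge0 ?exprn_ge0.
Qed.

(** * The two growth comparisons *)

Theorem theorem8p6 (R : realType) (h : {poly int})
    (hd0 : h`_0 != 0) (hdt : lead_coef h != 0) (c : R) (hc : 0 < c) :
  growth_equiv (distortion h c)
    (fun l : nat => (l%:R ^+ (max_unit_root_mult R h).+1)%:E).
Proof.
have h0 : h != 0 by rewrite -lead_coef_eq0.
split; last first.
  have [D HD] := large_quotient R h h0.
  set k := max_unit_root_mult R h in HD *.
  (* [B * l] dominates both the degree and the norm condition; [C] is chosen so that [c * (C * l)]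
     is at least [B * l]. *)
  pose B := (D + k.+1)%N; pose C := (Num.trunc (B%:R / c)).+1.
  have cC : B%:R <= c * C%:R.
    by rewrite mulrC -ler_pdivrMr // ltW // truncnS_gt.
  exists C; split=> // l.
  have sup0 : (0 <= distortion h c (C * l))%E.
    apply: ereal_sup_ubound; exists 0.
      rewrite /= /abs_coef_sum mulr0 size_poly0 big_ord0.
      by split; rewrite mulr_ge0 // ltW.
    by rewrite /abs_coef_sum size_poly0 big_ord0.
  (* At [l = 0] the left side vanishes, as the exponent is positive. *)
  have [l0|l0] := posnP l.
    by rewrite [in leLHS]l0 expr0n mule_ge0.
  have [f [sf hf lf]] := HD l l0.
  have Bl (m : nat) : (m <= B * l)%N -> m%:R <= c * (C * l)%:R.
    move=> mB; apply: le_trans (_ : (B * l)%:R <= _); first by rewrite ler_nat.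
    by rewrite !natrM mulrA ler_wpM2r.
  apply: (@le_trans _ _ (distortion h c (C * l))); last first.
    by rewrite lee_pemull // lee_fin ler1n.
  apply: (@le_trans _ _ (abs_coef_sum f)%:R%:E).
    by rewrite lee_fin -natrX ler_nat.
  apply: ereal_sup_ubound; exists f => //; split; apply: Bl.
    apply: leq_trans (leq_pred _) _; apply: leq_trans sf _.
    by rewrite leq_mul2r leq_addl orbT.
  by apply: leq_trans hf _; rewrite leq_mul2r leq_addr orbT.
have [C HC] := abs_coef_sum_upper R h h0.
set k := max_unit_root_mult R h in HC *.
pose m := (Num.trunc c).+1; have cm : c <= m%:R by rewrite ltW // truncnS_gt.
(* From [C * (m.+1 * l) ^ k * (m * l)]; the successor makes [B] positive. *)
pose B := (C * (m.+1 ^ k * m)).+1.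
exists B; split=> // l; apply: ge_ereal_sup => _ [f [sf hf] <-].
have ml (n : nat) : n%:R <= c * l%:R -> (n <= m * l)%N.
  by move=> le; rewrite -(ler_nat R) (le_trans le) // natrM ler_wpM2r.
rewrite -EFinM lee_fin -natrX -natrM ler_nat; apply: leq_trans (HC f) _.
have {}hf := ml _ hf; have {}sf := ml _ sf.
(* At [l = 0] the product [h * f] has norm 0, and so has the bound on [f]. *)
have [l0|l0] := posnP l.
  by move: hf; rewrite l0 muln0 leqn0 => /eqP ->; rewrite muln0.
(* The size exceeds the degree by at most 1, which is at most [l]. *)
have {}sf : (size f <= m.+1 * l)%N.
  by rewrite (leq_trans (leqSpred _)) // mulSn -add1n leq_add.
apply: (@leq_trans (B * l ^ k.+1)); last first.
  by rewrite leq_mul2l leq_exp2r // leq_pmull ?orbT.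
apply: (@leq_trans (C * (m.+1 * l) ^ k * (m * l))).
  rewrite leq_mul // leq_mul2l.
  (* [leq_exp2r] needs a positive exponent, so [k = 0] is separate. *)
  by case: (k) => [|k']; rewrite ?expn0 ?leq_exp2r ?sf ?orbT.
by rewrite expnMn (mulnA C) mulnACA -expnSr -(mulnA C) leq_mul2r leqnSn orbT.
Qed.
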